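(* Let $\sigma$ be a relational signature and let $\varphi(\bar x)$ be a first-order $\sigma$-formula with $|\bar x|>0$ that belongs to $\mathcal{B}\Sigma_{n,\ell}$. Then $\mathrm{lr}(\varphi)<(2\ell+1)^n\le\|\varphi\|^n$.
   Context: Structures are finite with non-empty universe. $\mathcal{B}\Sigma_{0,\ell}$ is the set of quantifier-free first-order formulas; a formula belongs to $\mathcal{B}\Sigma_{n+1,\ell}$ if it is a Boolean combination of formulas $\exists x_1\cdots\exists x_k\,\psi$ with $k\le\ell$ and $\psi\in\mathcal{B}\Sigma_{n,\ell}$. $\|\varphi\|$ is the length of $\varphi$ as a word. The Gaifman graph of $\mathcal{A}$ has vertex set $A$ and an edge between distinct elements occurring together in a tuple of some relation. For a tuple $\bar a$, $N_r^{\mathcal{A}}(\bar a)$ is the set of elements at Gaifman distance $\le r$ from an entry of $\bar a$, and the $r$-sphere of $\bar a$ is the induced substructure on $N_r^{\mathcal{A}}(\bar a)$ with distinguished tuple $\bar a$. $(\mathcal{A},\bar a)$ and $(\mathcal{B},\bar b)$ ($\bar a\in A^k$, $\bar b\in B^k$) are $r$-equivalent if there is a bijection $f:A\to B$ such that for all $c\in A$ the $r$-spheres of $(\bar a,c)$ and $(\bar b,f(c))$ are isomorphic (respecting distinguished tuples). $\varphi(\bar x)$ is Hanf-local if some $r\ge0$ satisfies: whenever $(\mathcal{A},\bar a)$ and $(\mathcal{B},\bar b)$ are $r$-equivalent, $\mathcal{A}\models\varphi[\bar a]\iff\mathcal{B}\models\varphi[\bar b]$; the least such $r$ is $\mathr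m{lr}(\varphi)$.
   Formalization: The second inequality (2ℓ+1)^n ≤ ‖φ‖^n is stated only for the least ℓ with φ in BΣ_{n,ℓ} (for larger ℓ it fails, e.g. φ = R(x), n = 1, ℓ = 100); the bound lr(φ) < (2ℓ+1)^n is stated for every ℓ. *)

(* Defs.v *)
From mathcomp Require Import all_boot.
Set Implicit Arguments. Unset Strict Implicit. Unset Printing Implicit Defensive.

Record signature := Signature { sym : Type; arity : sym -> nat }.

Section FO.
Variable s : signature.

Inductive formula :=
| FEq of nat & nat
| FRel (R : sym s) of (arity R).-tuple nat
| FNot of formula
| FAnd of formula & formula
| FOr of formula & formula
| FEx of nat & formula
| FAll of nat & formula.

(* Length as a word: atoms "x = y" (3 symbols), "R x1 ... xk" (k+1 symbols);
   "~ f" ; "( f /\ g )", "( f \/ g )"; "Ex x f", "All x f". *)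
Fixpoint flen (f : formula) : nat :=
  match f with
  | FEq _ _ => 3
  | FRel R _ => (arity R).+1
  | FNot g => (flen g).+1
  | FAnd g h | FOr g h => flen g + flen h + 3
  | FEx _ g | FAll _ g => (flen g).+2
  end.

Fixpoint qfree (f : formula) : bool :=
  match f with
  | FEq _ _ | FRel _ _ => true
  | FNot g => qfree g
  | FAnd g h | FOr g h => qfree g && qfree h
  | FEx _ _ | FAll _ _ => false
  end.

Fixpoint fv (f : formula) : seq nat :=
  match f with
  | FEq x y => [:: x; y]
  | FRel _ xs => val xs
  | FNot g => fv g
  | FAnd g h | FOr g h => fv g ++ fv h
  | FEx x g | FAll x g => filter (predC1 x) (fv g)
  end.

Inductive bcomb (S : formula -> Prop) : formula -> Prop :=
| bc_base f : S f -> bcomb S f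
| bc_not f : bcomb S f -> bcomb S (FNot f)
| bc_and f g : bcomb S f -> bcomb S g -> bcomb S (FAnd f g)
| bc_or f g : bcomb S f -> bcomb S g -> bcomb S (FOr f g).

Definition exs (xs : seq nat) (psi : formula) : formula := foldr FEx psi xs.

Fixpoint BSigma (n l : nat) : formula -> Prop :=
  match n with
  | 0 => fun f => qfree f
  | n'.+1 => bcomb (fun chi => exists (xs : seq nat) (psi : formula),
                      size xs <= l /\ BSigma n' l psi /\ chi = exs xs psi)
  end.

Record structure := Structure {
  univ :> finType;
  elt0 : univ;
  rel : forall R : sym s, pred ((arity R).-tuple univ) }.

Definition upd (A : structure) (nu : nat -> A) (x : nat) (a : A) : nat -> A :=
  fun y => if y == x then a else nu y.

Fixpoint sat (A : structure) (nu : nat -> A) (f : formula) : Prop :=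
  match f with
  | FEq x y => nu x = nu y
  | FRel R xs => @rel A R (map_tuple nu xs)
  | FNot g => ~ sat nu g
  | FAnd g h => sat nu g /\ sat nu h
  | FOr g h => sat nu g \/ sat nu h
  | FEx x g => exists a : A, sat (upd nu x a) g
  | FAll x g => forall a : A, sat (upd nu x a) g
  end.

Definition asg (A : structure) (a : seq A) : nat -> A := fun v => nth (elt0 A) a v.

Definition gadj (A : structure) (x y : A) : Prop :=
  x <> y /\ exists (R : sym s) (t : (arity R).-tuple A), @rel A R t /\ x \in t /\ y \in t.

Fixpoint nbhd (A : structure) (r : nat) (a : seq A) : A -> Prop :=
  match r with
  | 0 => fun y => y \in a
  | r'.+1 => fun y => nbhd r' a y \/ exists x, nbhd r' a x /\ gadj x y
  end.

Definition sphere_iso (A B : structure) (r : nat) (a : seq A) (b : seq B) : Prop :=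
  size a = size b /\
  exists g : A -> B,
    (forall x, nbhd r a x -> nbhd r b (g x)) /\
    (forall x y, nbhd r a x -> nbhd r a y -> g x = g y -> x = y) /\
    (forall y, nbhd r b y -> exists x, nbhd r a x /\ g x = y) /\
    map g a = b /\
    (forall (R : sym s) (t : (arity R).-tuple A),
        (forall x, x \in t -> nbhd r a x) -> @rel A R t = @rel B R (map_tuple g t)).

Definition r_equiv (A B : structure) (r : nat) (a : seq A) (b : seq B) : Prop :=
  exists f : A -> B, bijective f /\
    forall c : A, sphere_iso r (rcons a c) (rcons b (f c)).

Definition hanf_at (k : nat) (phi : formula) (r : nat) : Prop :=
  forall (A B : structure) (a : k.-tuple A) (b : k.-tuple B),
    r_equiv r a b -> (sat (asg a) phi <-> sat (asg b) phi).

End FO.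

(* Main.v *)
Require Import Defs.
From mathcomp Require Import all_boot.
From mathcomp Require Import boolp zify.

(** The type of a finite family is the isomorphism type of its [r]-sphere together
    with its links, the pairs of entries at distance at most [2 r + 1]. If the
    [R]-spheres of [a] and [b] are isomorphic and a bijection between the two
    structures preserves the [R]-sphere of every single element, then every type
    of a family extending [a] by [m] entries has as many realizations over [a] as
    over [b], provided [m (2 r + 1) + r + 1 <= R]. Indeed a family chained by links
    to [a] (or to one of its own entries) stays in a ball of radius
    [m (2 r + 1)] and is transported by the isomorphism, and a family falling into two
    unlinked parts is counted by inclusion-exclusion. A whole block of [l]
    quantifiers therefore costs only [r |-> (2 l + 1) r + 2 l], instead of the
    factor [3 ^ l] of [l] successive single moves, and [(2 l + 1) ^ n - 1] is the
    [n]-th iterate of this map at [0]. *)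

Set Implicit Arguments. Unset Strict Implicit. Unset Printing Implicit Defensive.

(** * Balls and isomorphisms of spheres *)

Section Spheres.
Variable s : signature.
Implicit Types A B C : structure s.

(** Reflexive Gaifman adjacency, so that paths of exactly [r] steps describe distance at most
    [r]. *)
Definition touch A (x y : A) : Prop :=
  x = y \/ exists (R : sym s) (t : (arity R).-tuple A),
    [/\ @Defs.rel s A R t, x \in t & y \in t].

Fixpoint ball A (r : nat) (x y : A) : Prop :=
  if r is r'.+1 then exists2 z, ball r' x z & touch z y else x = y.

(** Families are indexed by any type and cut down to [S]: variables, tuple positions and single
    points are then treated alike, and subfamilies keep their indices. *)
Definition nb A (K : Type) (S : {pred K}) (r : nat) (u : K -> A) (x : A) : Prop :=
  exists2 i, i \in S & ball r (u i) x.

Lemma touch_sym A (x y : A) : touch x y -> touch y x.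
Proof.
by case=> [->|[R [t [Rt xt yt]]]]; [left | right; exists R, t; split].
Qed.

Lemma touch_tnth A (R : sym s) (t : (arity R).-tuple A) i j :
  @Defs.rel s A R t -> touch (tnth t i) (tnth t j).
Proof. by move=> Rt; right; exists R, t; rewrite !mem_tnth. Qed.

Lemma ball_trans A m n (x y z : A) : ball m x y -> ball n y z -> ball (m + n) x z.
Proof.
elim: n z => [|n IH] z xy /=; first by move=> <-; rewrite addn0.
by case=> z' yz' tz; rewrite addnS; exists z' => //; apply: IH.
Qed.

Lemma ball_split A m n (x z : A) : ball (m + n) x z -> exists2 y, ball m x y & ball n y z.
Proof.
elim: n z => [|n IH] z; first by rewrite addn0 => h; exists z.
by rewrite addnS => -[z' /IH[y xy yz'] tz]; exists y => //; exists z'.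
Qed.

Lemma touch_ball A (x y : A) : touch x y -> ball 1 x y.
Proof. by exists x. Qed.

Lemma ball_sym A n (x y : A) : ball n x y -> ball n y x.
Proof.
elim: n y => [|n IH] y //; case=> z /IH zx /touch_sym/touch_ball yz.
by rewrite -add1n; apply: ball_trans yz zx.
Qed.

Lemma ball_refl A n (x : A) : ball n x x.
Proof. by elim: n => [//|n IH]; exists x => //; left. Qed.

Lemma ball_le A m n (x y : A) : m <= n -> ball m x y -> ball n x y.
Proof. by move=> /subnKC <- xy; apply: ball_trans xy (ball_refl _ _). Qed.

Lemma nb_le A (K : Type) (S : {pred K}) m n (u : K -> A) x :
  m <= n -> nb S m u x -> nb S n u x.
Proof. by move=> mn [i iS /(ball_le mn)]; exists i. Qed.

Lemma nb_ball A (K : Type) (S : {pred K}) m n (u : K -> A) x y :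
  nb S m u x -> ball n x y -> nb S (m + n) u y.
Proof. by case=> i iS ux xy; exists i => //; apply: ball_trans ux xy. Qed.

Lemma nbhd_ball A r (a : seq A) y :
  nbhd r a y <-> exists2 x, x \in a & ball r x y.
Proof.
elim: r y => [|r IH] y /=; first by split=> [ya|[x xa <-]] //; exists y.
split=> [[/IH[x xa xy]|[z [/IH[x xa xz] [_ [R [t [Rt [zt yt]]]]]]]]|].
- by exists x => //; exists y => //; left.
- by exists x => //; exists z => //; right; exists R, t.
case=> x xa [z xz]; have nz : nbhd r a z by apply/IH; exists x.
case: (EM (z = y)) => [<-|zy] tz; first by left.
by case: tz => // -[R [t [Rt zt yt]]]; right; exists z; split=> //; split=> //; exists R, t.
Qed.

(* Isomorphisms are kept as relations, so that inverting them and gluing them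
   along disjoint spheres need no choice of preimages. *)
Record isom A B (K : Type) (S : {pred K}) (r : nat) (u : K -> A) (v : K -> B)
    (G : A -> B -> Prop) : Prop := Isom {
  isom_doml : forall x y, G x y -> nb S r u x;
  isom_domr : forall x y, G x y -> nb S r v y;
  isom_total : forall x, nb S r u x -> exists y, G x y;
  isom_surj : forall y, nb S r v y -> exists x, G x y;
  isom_fun : forall x y y', G x y -> G x y' -> y = y';
  isom_inj : forall x x' y, G x y -> G x' y -> x = x';
  isom_base : forall i, i \in S -> G (u i) (v i);
  isom_rel : forall (R : sym s) (t : (arity R).-tuple A) (t' : (arity R).-tuple B),
    (forall i, G (tnth t i) (tnth t' i)) -> @Defs.rel s A R t = @Defs.rel s B R t' }.

Definition iso A B (K : Type) (S : {pred K}) (r : nat) (u : K -> A) (v : K -> B) :=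
  exists G, isom S r u v G.

Lemma isom_sym A B (K : Type) (S : {pred K}) r (u : K -> A) (v : K -> B) G :
  isom S r u v G -> isom S r v u (fun y x => G x y).
Proof.
case=> dl dr tot sur fn inj ba re; split=> //.
- by move=> y x; apply: dr.
- by move=> y x; apply: dl.
- by move=> y x x'; apply: inj.
- by move=> y y' x; apply: fn.
- by move=> R t t' tt'; rewrite (re R t' t).
Qed.

Lemma iso_sym A B (K : Type) (S : {pred K}) r (u : K -> A) (v : K -> B) :
  iso S r u v -> iso S r v u.
Proof. by case=> G /isom_sym; exists (fun y x => G x y). Qed.

Lemma iso_refl A (K : Type) (S : {pred K}) r (u : K -> A) : iso S r u u.
Proof.
exists (fun x y => x = y /\ nb S r u x); split.
- by move=> x y [].
- by move=> x y [<-].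
- by move=> x ux; exists x.
- by move=> x ux; exists x.
- by move=> x y y' [<- _] [<-].
- by move=> x x' y [-> _] [->].
- by move=> i iS; split=> //; exists i => //; apply: ball_refl.
- by move=> R t t' tt'; congr (Defs.rel _); apply: eq_from_tnth => i; case: (tt' i).
Qed.

Lemma iso_trans A B C (K : Type) (S : {pred K}) r (u : K -> A) (v : K -> B) (w : K -> C) :
  iso S r u v -> iso S r v w -> iso S r u w.
Proof.
case=> G Gi [H Hi]; exists (fun x z => exists2 y, G x y & H y z); split.
- by move=> x z [y /(isom_doml Gi)].
- by move=> x z [y _ /(isom_domr Hi)].
- move=> x /(isom_total Gi)[y xy].
  by have [z yz] := isom_total Hi (isom_domr Gi xy); exists z, y.
- move=> z /(isom_surj Hi)[y yz].
  by have [x xy] := isom_surj Gi (isom_doml Hi yz); exists x, y.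
- move=> x z z' [y xy yz] [y' xy' yz']; move: yz'.
  by rewrite -(isom_fun Gi xy xy') => yz'; apply: (isom_fun Hi yz yz').
- move=> x x' z [y xy yz] [y' xy' yz']; move: xy'.
  by rewrite -(isom_inj Hi yz yz') => xy'; apply: (isom_inj Gi xy xy').
- by move=> i iS; exists (v i); [apply: (isom_base Gi iS) | apply: (isom_base Hi iS)].
- move=> R t t' /fin_all_exists2[f tf ft].
  have -> := isom_rel Gi (t' := [tuple f i | i < arity R]).
    by apply: (isom_rel Hi) => i; rewrite tnth_mktuple.
  by move=> i; rewrite tnth_mktuple.
Qed.

(** The tuple witnessing a step of the path has all its entries within [m + n] of [u], hence in the
    [R]-sphere, so [G] carries the whole tuple over and with it the step. *)
Lemma isom_ball A B (K : Type) (S : {pred K}) R (u : K -> A) (v : K -> B) G m n x x' y :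
  isom S R u v G -> nb S m u x -> G x y -> m + n <= R -> ball n x x' ->
  exists2 y', G x' y' & ball n y y'.
Proof.
move=> Gi ux xy; elim: n x' => [|n IH] x' mn /=; first by move=> <-; exists y.
case=> z xz tz; have [yz zyz byz] := IH z (ltac:(lia)) xz.
case: tz => [<-|[Q [t [Qt /tnthP[i zi] /tnthP[j x'j]]]]].
  by exists yz => //; exists yz => //; left.
have /fin_all_exists[f fP] k : exists q, G (tnth t k) q.
  apply: (isom_total Gi); apply: (nb_le mn); rewrite addnS -addn1.
  apply: nb_ball (nb_ball ux xz) _; apply: touch_ball.
  by rewrite zi; apply: touch_tnth.
exists (f j); first by rewrite x'j.
exists yz => //; have -> : yz = f i.
  by apply: (isom_fun Gi zyz); rewrite zi.
have := @touch_tnth B Q [tuple f k | k < arity Q] i j.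
rewrite !tnth_mktuple; apply; rewrite -(isom_rel Gi (t := t)) // => k.
by rewrite tnth_mktuple.
Qed.

Lemma isom_nb A B (K : Type) (S : {pred K}) R (u : K -> A) (v : K -> B) G m x y :
  isom S R u v G -> m <= R -> nb S m u x -> G x y -> nb S m v y.
Proof.
move=> Gi mR [i iS ux] xy.
have ui : nb S 0 u (u i) by exists i.
have [y' xy' vy'] := isom_ball Gi ui (isom_base Gi iS) mR ux.
by exists i; rewrite // (isom_fun Gi xy xy').
Qed.

(** The [r]-balls around the inner points lie in the [R]-sphere, so their paths are transported both
    ways and [G] maps one small sphere onto the other. *)
Lemma isom_restrict A B (K K' : Type) (S : {pred K}) (S' : {pred K'}) R m r
    (u : K -> A) (v : K -> B) (x : K' -> A) (y : K' -> B) G :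
  isom S R u v G -> m + r <= R ->
  (forall j, j \in S' -> nb S m u (x j)) -> (forall j, j \in S' -> G (x j) (y j)) ->
  iso S' r x y.
Proof.
move=> Gi mr ux xy; exists (fun p q => G p q /\ nb S' r x p); split.
- by move=> p q [].
- move=> p q [pq [j jS xp]].
  have [q' pq' yq'] := isom_ball Gi (ux j jS) (xy j jS) mr xp.
  by exists j; rewrite // (isom_fun Gi pq pq').
- move=> p xp; have [j jS bp] := xp.
  by have [q pq _] := isom_ball Gi (ux j jS) (xy j jS) mr bp; exists q.
- move=> q [j jS yq].
  have vy : nb S m v (y j) by apply: isom_nb Gi _ (ux j jS) (xy j jS); lia.
  have [p pq xp] := isom_ball (isom_sym Gi) vy (xy j jS) mr yq.
  by exists p; split=> //; exists j.
- by move=> p q q' [pq _] [pq' _]; apply: (isom_fun Gi pq pq').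
- by move=> p p' q [pq _] [pq' _]; apply: (isom_inj Gi pq pq').
- by move=> j jS; split; [apply: xy | exists j => //; apply: ball_refl].
- by move=> Q t t' tt'; apply: (isom_rel Gi) => i; case: (tt' i).
Qed.

Lemma iso_sub A B (K K' : Type) (S : {pred K}) (S' : {pred K'}) R r
    (u : K -> A) (v : K -> B) (x : K' -> A) (y : K' -> B) :
  iso S R u v -> r <= R ->
  (forall j, j \in S' -> exists i, [/\ i \in S, x j = u i & y j = v i]) ->
  iso S' r x y.
Proof.
case=> G Gi rR h; apply: (@isom_restrict _ _ _ _ _ _ R 0 r _ _ _ _ G Gi) => // j /h.
  by case=> i [iS -> _]; exists i.
by case=> i [iS -> ->]; apply: (isom_base Gi iS).
Qed.

(* A path of length [2 r + 1] between points of the [m]-sphere stays, together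
   with the tuples witnessing its edges, in the [(m + r + 1)]-sphere. *)
Lemma isom_link A B (K : Type) (S : {pred K}) R (u : K -> A) (v : K -> B) G m r x x' y y' :
  isom S R u v G -> m + r + 1 <= R -> nb S m u x -> nb S m u x' -> G x y -> G x' y' ->
  ball (2 * r + 1) x x' -> ball (2 * r + 1) y y'.
Proof.
move=> Gi mr ux ux' xy xy'.
have mr' : m + r <= R by lia.
have -> : 2 * r + 1 = r + 1 + r by lia.
case/ball_split=> p' /ball_split[p xp pp'] /ball_sym x'p'.
have [q pq yq] := isom_ball Gi ux xy mr' xp.
have [q' pq' yq'] := isom_ball Gi ux' xy' mr' x'p'.
have [q'' pq'' qq''] := isom_ball Gi (nb_ball ux xp) pq mr pp'.
rewrite (isom_fun Gi pq'' pq') in qq''.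
by apply: ball_trans (ball_trans yq qq'') (ball_sym yq').
Qed.

(** A common point of the two [r]-spheres, or a tuple of a relation meeting both, would give a path
    of length [2 r + 1] between the parts. Hence the union of the two isomorphisms is again one. *)
Lemma iso_glue A B (K : Type) (S0 S1 S : {pred K}) r (u : K -> A) (v : K -> B) :
  S =i [predU S0 & S1] -> iso S0 r u v -> iso S1 r u v ->
  (forall i j, i \in S0 -> j \in S1 -> ~ ball (2 * r + 1) (u i) (u j)) ->
  (forall i j, i \in S0 -> j \in S1 -> ~ ball (2 * r + 1) (v i) (v j)) ->
  iso S r u v.
Proof.
move=> SE [G Gi] [H Hi] nu nv.
have S0S i : i \in S0 -> i \in S by rewrite SE inE /= => ->.
have S1S i : i \in S1 -> i \in S by rewrite SE inE /= orbC => ->.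
have nbE C (w : K -> C) x : nb S r w x -> nb S0 r w x \/ nb S1 r w x.
  by case=> i; rewrite SE => /orP[] iS wx; [left | right]; exists i.
have far C (w : K -> C) : (forall i j, i \in S0 -> j \in S1 -> ~ ball (2 * r + 1) (w i) (w j)) ->
    forall x y, nb S0 r w x -> nb S1 r w y -> ~ touch x y.
  move=> nw x y [i iS wx] [j jS /ball_sym wy] /touch_ball xy.
  apply: (nw i j iS jS); have -> : 2 * r + 1 = r + 1 + r by lia.
  exact: ball_trans (ball_trans wx xy) wy.
have farU := far _ _ nu; have farV := far _ _ nv.
exists (fun x y => G x y \/ H x y); split.
- by move=> x y [/(isom_doml Gi)|/(isom_doml Hi)] [i iS wx]; exists i; auto.
- by move=> x y [/(isom_domr Gi)|/(isom_domr Hi)] [i iS wx]; exists i; auto.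
- by move=> x /nbE[/(isom_total Gi)|/(isom_total Hi)] [y xy]; exists y; auto.
- by move=> x /nbE[/(isom_surj Gi)|/(isom_surj Hi)] [y xy]; exists y; auto.
- move=> x y y' [xy|xy] [xy'|xy']; first exact: (isom_fun Gi xy xy').
  + by case: (farU _ _ (isom_doml Gi xy) (isom_doml Hi xy')); left.
  + by case: (farU _ _ (isom_doml Gi xy') (isom_doml Hi xy)); left.
  + exact: (isom_fun Hi xy xy').
- move=> x x' y [xy|xy] [xy'|xy']; first exact: (isom_inj Gi xy xy').
  + by case: (farV _ _ (isom_domr Gi xy) (isom_domr Hi xy')); left.
  + by case: (farV _ _ (isom_domr Gi xy') (isom_domr Hi xy)); left.
  + exact: (isom_inj Hi xy xy').
- move=> i; rewrite SE => /orP[] iS; first by left; apply: (isom_base Gi iS).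
  by right; apply: (isom_base Hi iS).
- move=> R t t' tt'.
  case: (EM (forall i, G (tnth t i) (tnth t' i))); first exact: (isom_rel Gi).
  case: (EM (forall i, H (tnth t i) (tnth t' i))); first by move=> h _; apply: (isom_rel Hi).
  move=> /existsNP[i nHi] /existsNP[j nGj].
  have Gti : G (tnth t i) (tnth t' i) by case: (tt' i).
  have Htj : H (tnth t j) (tnth t' j) by case: (tt' j).
  apply/idP/idP => /(touch_tnth i j) tij.
    by case: (farU _ _ (isom_doml Gi Gti) (isom_doml Hi Htj)).
  by case: (farV _ _ (isom_domr Gi Gti) (isom_domr Hi Htj)).
Qed.

Lemma sphere_iso_iso A B r (a : seq A) (b : seq B) :
  sphere_iso r a b -> iso [pred i | i < size a] r (asg a) (asg b).
Proof.
case=> sab [g [gn [ginj [gsur [gab grel]]]]].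
have nbE C (c : seq C) x : nbhd r c x <-> nb [pred i | i < size c] r (asg c) x.
  split=> [/nbhd_ball[z zc zx]|[i ic cx]].
    by exists (index z c); rewrite ?inE ?index_mem // /asg nth_index.
  by apply/nbhd_ball; exists (asg c i) => //; apply: mem_nth.
exists (fun x y => nbhd r a x /\ g x = y); split.
- by move=> x y [/nbE].
- by move=> x y [/gn h <-]; rewrite sab; apply/nbE.
- by move=> x /nbE ax; exists (g x).
- by move=> y; rewrite sab => /nbE/gsur.
- by move=> x y y' [_ <-] [_ <-].
- by move=> x x' y [ax <-] [ax' /esym]; apply: ginj.
- move=> i ia; split; last by rewrite /asg -gab (nth_map (elt0 A)).
  by apply/nbE; exists i => //; apply: ball_refl.
- move=> R t t' tt'; rewrite grel => [|x /tnthP[i ->]]; last by case: (tt' i).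
  by congr (Defs.rel _); apply: eq_from_tnth => i; rewrite tnth_map; case: (tt' i).
Qed.

End Spheres.

(** * Counting families by their type *)

(** Exchanging the coordinates outside [S0] is an involution on pairs. It turns a pair with [Q0 x]
    and [Q1 y] into one whose first member satisfies both and whose second is arbitrary. *)
Lemma card_indep (K T : finType) (S0 S1 : {set K}) (Q0 Q1 : pred {ffun K -> T}) :
  [disjoint S0 & S1] ->
  (forall x y : {ffun K -> T}, {in S0, x =1 y} -> Q0 x = Q0 y) ->
  (forall x y : {ffun K -> T}, {in S1, x =1 y} -> Q1 x = Q1 y) ->
  #|[set x | Q0 x]| * #|[set x | Q1 x]| =
  #|[set x | Q0 x && Q1 x]| * #|{: {ffun K -> T}}|.
Proof.
move=> dS Q0S Q1S.
pose mix (x y : {ffun K -> T}) := [ffun k => if k \in S0 then x k else y k].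
pose swap p := (mix p.1 p.2, mix p.2 p.1).
have swapK : involutive swap.
  by case=> x y; congr (_, _); apply/ffunP=> k; rewrite !ffunE; case: (k \in S0).
rewrite -cardsT -!cardsX -[RHS](card_preimset _ (inv_inj swapK)).
congr #|pred_of_set _|; apply/setP=> -[x y]; rewrite !inE andbT; congr (_ && _).
  by apply: Q0S => k kS; rewrite ffunE kS.
by apply: Q1S => k kS; rewrite ffunE (disjointFl dS kS).
Qed.

(** [Q] is a union of classes of [e], so the counts are summed class by class. As [W] may be
    infinite, a class is named by its traces on [U] and [V], which take finitely many values. *)
Lemma card_classes (U V : finType) (W : Type) (e : W -> W -> Prop)
    (f : U -> W) (g : V -> W) (X : pred U) (Y : pred V) (Q : W -> Prop) :
  (forall w, e w w) -> (forall w w', e w w' -> e w' w) ->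
  (forall w1 w2 w3, e w1 w2 -> e w2 w3 -> e w1 w3) ->
  (forall w w', e w w' -> Q w -> Q w') ->
  (forall w, Q w -> #|[set x | X x && `[< e (f x) w >]]| =
                    #|[set y | Y y && `[< e (g y) w >]]|) ->
  #|[set x | X x && `[< Q (f x) >]]| = #|[set y | Y y && `[< Q (g y) >]]|.
Proof.
move=> er es et eQ cQ.
pose code w := ([set x | `[< e (f x) w >]], [set y | `[< e (g y) w >]]).
have codeE w w' : e w w' -> code w = code w'.
  move=> ww'; congr (_, _); apply/setP=> z; rewrite !inE;
    apply/asboolP/asboolP => h; [exact: et h ww' | exact: et h (es _ _ ww')
                                |exact: et h ww' | exact: et h (es _ _ ww')].
have codef x w : code (f x) = code w -> e (f x) w.
  by case=> /setP/(_ x); rewrite !inE => h _; apply/asboolP; rewrite -h; apply/asboolP.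
have codeg y w : code (g y) = code w -> e (g y) w.
  by case=> _ /setP/(_ y); rewrite !inE => h; apply/asboolP; rewrite -h; apply/asboolP.
have part (Z : finType) (D : pred Z) (h : Z -> {set U} * {set V}) :
    #|[set z | D z]| = \sum_c #|[set z | D z && (h z == c)]|.
  rewrite -sum1dep_card (partition_big h predT) //=.
  by apply: eq_bigr => c _; rewrite sum1dep_card.
rewrite (part _ _ (code \o f)) (part _ _ (code \o g)); apply: eq_bigr => c _.
case: (EM (exists2 w, Q w & code w = c)) => [[w Qw <-]|nw].
  transitivity #|[set x | X x && `[< e (f x) w >]]|; [|rewrite cQ //];
    apply: eq_card => z; rewrite !inE -andbA; congr (_ && _).
    apply/andP/asboolP => [[_ /eqP/codef] //|zw]; split; last by rewrite /= (codeE _ _ zw).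
    by apply/asboolP; apply: eQ Qw; apply: es.
  apply/asboolP/andP => [zw|[_ /eqP/codeg] //]; split; last by rewrite /= (codeE _ _ zw).
  by apply/asboolP; apply: eQ Qw; apply: es.
(* A code that no element of [Q] carries contributes nothing on either side. *)
by rewrite !eq_card0 // => z; rewrite !inE; apply/negP=> /andP[/andP[_ /asboolP Qz] /eqP zc];
  apply: nw; first [exists (g z); done | exists (f z); done].
Qed.

Section Types.
Variable s : signature.
Implicit Types A B C : structure s.

(* [2 r + 1] is the largest distance at which two [r]-spheres can meet or be
   joined by a tuple, so unlinked families have independent spheres. *)
Definition link A r (x y : A) : Prop := ball (2 * r + 1) x y.

(* The [r]-sphere alone need not show links of length exactly [2 r + 1], whose
   middle tuple may leave the sphere; hence the second clause. *)
Definition teq A B (K : Type) (S : {pred K}) r (u : K -> A) (v : K -> B) : Prop :=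
  iso S r u v /\
  forall i j, i \in S -> j \in S -> link r (u i) (u j) <-> link r (v i) (v j).

Lemma teq_refl A (K : Type) (S : {pred K}) r (u : K -> A) : teq S r u u.
Proof. by split=> //; apply: iso_refl. Qed.

Lemma teq_sym A B (K : Type) (S : {pred K}) r (u : K -> A) (v : K -> B) :
  teq S r u v -> teq S r v u.
Proof. by case=> /iso_sym uv l; split=> // i j iS jS; rewrite l. Qed.

Lemma teq_trans A B C (K : Type) (S : {pred K}) r (u : K -> A) (v : K -> B) (w : K -> C) :
  teq S r u v -> teq S r v w -> teq S r u w.
Proof.
case=> uv l [vw l']; split; first exact: iso_trans uv vw.
by move=> i j iS jS; rewrite l // l'.
Qed.

Lemma teq_sub A B (K : Type) (S S' : {pred K}) r (u : K -> A) (v : K -> B) :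
  {subset S' <= S} -> teq S r u v -> teq S' r u v.
Proof.
move=> SS [uv l]; split; last by move=> i j /SS iS /SS jS; apply: l.
by apply: iso_sub uv _ _ => // i /SS iS; exists i.
Qed.

Lemma eq_teq A B (K : Type) (S : {pred K}) r (u u' : K -> A) (v : K -> B) :
  {in S, u =1 u'} -> teq S r u v -> teq S r u' v.
Proof.
move=> uu' [uv l]; split; last by move=> i j iS jS; rewrite -!uu' //; apply: l.
by apply: iso_sub uv _ _ => // i iS; exists i; rewrite uu'.
Qed.

Lemma teq_glue A B (K : Type) (S0 S1 S : {pred K}) r (u : K -> A) (v : K -> B) :
  S =i [predU S0 & S1] -> teq S0 r u v -> teq S1 r u v ->
  (forall i j, i \in S0 -> j \in S1 -> ~ link r (u i) (u j)) ->
  (forall i j, i \in S0 -> j \in S1 -> ~ link r (v i) (v j)) ->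
  teq S r u v.
Proof.
move=> SE [i0 l0] [i1 l1] nu nv; split; first exact: iso_glue SE i0 i1 nu nv.
move=> i j; rewrite !SE => /orP[] iS /orP[] jS.
- exact: l0.
- by split=> h; [case: (nu i j) | case: (nv i j)].
- by split=> /ball_sym h; [case: (nu j i) | case: (nv j i)].
- exact: l1.
Qed.

(** For [P] inside [S]: every index of [S] is reached from [P] by links within [S]. The form with
    cuts makes the negation yield an unlinked splitting of [S] at once. *)
Definition chained A (K : finType) (S P : {set K}) r (u : K -> A) : Prop :=
  forall S0 : {set K}, P \subset S0 -> S0 \subset S -> S0 != S ->
  exists i j, [/\ i \in S0, j \in S :\: S0 & link r (u i) (u j)].

(** Let [L t] collect the entries within [t] link lengths of [P]. As long as [L t] is not [S], some
    link leaves it and the next layer gains an index, so [#|S :\: P|] layers suffice. *)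
Lemma chained_nb A (K : finType) (S P : {set K}) r (u : K -> A) :
  chained S P r u -> P \subset S ->
  forall j, j \in S -> nb P (#|S :\: P| * (2 * r + 1)) u (u j).
Proof.
move=> ch PS.
pose L t := [set j in S | `[< nb P (t * (2 * r + 1)) u (u j) >]].
have PL t : P \subset L t.
  apply/subsetP=> j jP; rewrite inE (subsetP PS) //=.
  by apply/asboolP; exists j => //; apply: ball_refl.
have LS t : L t \subset S by apply/subsetP=> j; rewrite inE => /andP[].
have Lle t : L t \subset L t.+1.
  apply/subsetP=> j; rewrite !inE => /andP[-> /asboolP h] /=.
  by apply/asboolP; apply: nb_le h; rewrite leq_mul2r leqnSn orbT.
have grow t : L t = S \/ t <= #|L t :\: P|.
  elim: t => [|t IH]; first by right.
  case: (eqVneq (L t) S) => [E|neS].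
    by left; apply/eqP; rewrite eqEsubset LS -{1}E Lle.
  case: IH => [E|IH]; first by rewrite E eqxx in neS.
  have [i [j [iL jL ij]]] := ch _ (PL t) (LS t) neS.
  have jL1 : j \in L t.+1.
    move: jL iL; rewrite !inE => /andP[_ ->] /andP[_ /asboolP ui] /=.
    by apply/asboolP; rewrite mulSn addnC; apply: nb_ball ui ij.
  right; apply: (@leq_trans #|j |: (L t :\: P)|).
    rewrite cardsU1; have -> : j \notin L t :\: P.
      by move: jL; rewrite inE => /andP[nj _]; rewrite inE (negPf nj) andbF.
    by rewrite add1n.
  apply/subset_leq_card/subsetP=> k; rewrite in_setU1 => /orP[/eqP->|].
    rewrite in_setD jL1 andbT; apply: contraTN jL => /(subsetP (PL t)) jL.
    by rewrite in_setD jL.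
  by rewrite !in_setD => /andP[-> /(subsetP (Lle t)) ->].
have LE : L #|S :\: P| = S.
  case: (grow #|S :\: P|) => // le; apply/eqP; rewrite eqEsubset LS /=.
  have /eqP E : L #|S :\: P| :\: P == S :\: P by rewrite eqEcard le setSD.
  apply/subsetP=> j jS; case: (boolP (j \in P)) => jP; first exact: (subsetP (PL _)).
  by have /setDP[] : j \in L #|S :\: P| :\: P by rewrite E inE jP.
by move=> j; rewrite -{1}LE inE => /andP[_ /asboolP].
Qed.

Definition agree A (K : finType) (P : {set K}) (a x : K -> A) : bool :=
  [forall i in P, x i == a i].

Lemma agreeP A (K : finType) (P : {set K}) (a x : K -> A) :
  reflect {in P, x =1 a} (agree P a x).
Proof. by apply: (iffP forall_inP) => h i iP; apply/eqP/h. Qed.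

(** Entries outside [S] stay free, so that realizations for different [S] live in one space, where
    unlinked parts are independent. *)
Definition realizations A C (K : finType) (S P : {set K}) r (a : K -> A) (w : K -> C) :=
  [set x : {ffun K -> A} | agree P a x && `[< teq S r x w >]].

(** A realization has the links of [w] on [S], so it is chained too and stays near [a]: there [G]
    moves its entries, while [f] moves the free ones injectively. The margin [r + 1] lets [G]
    preserve [r]-spheres and links. *)
Lemma card_chained_le A B C (K : finType) (S P : {set K}) R r
    (a : K -> A) (b : K -> B) (w : K -> C) (f : A -> B) :
  injective f -> iso P R a b -> P \subset S -> #|S :\: P| * (2 * r + 1) + r + 1 <= R ->
  chained S P r w -> #|realizations S P r a w| <= #|realizations S P r b w|.
Proof.
move=> finj [G Gi] PS mR ch.
have /fin_all_exists[h hP] x : exists y, nb P R a x -> G x y.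
  case: (EM (nb P R a x)) => [/(isom_total Gi)[y xy]|nx]; first by exists y.
  by exists (elt0 B).
pose F (x : {ffun K -> A}) := [ffun j => if j \in S then h (x j) else f (x j)].
have near (x : {ffun K -> A}) j : x \in realizations S P r a w -> j \in S ->
    nb P (#|S :\: P| * (2 * r + 1)) a (x j).
  rewrite inE => /andP[/agreeP xa /asboolP xw] jS.
  have chx : chained S P r x.
    move=> S0 PS0 S0S neS; have [i [k [iS kS ik]]] := ch _ PS0 S0S neS.
    exists i, k; split=> //; apply/xw.2 => //; first exact: (subsetP S0S).
    by move: kS; rewrite inE => /andP[].
  by have [i iP] := chained_nb chx PS jS; exists i; rewrite // -xa.
have nearG x j : x \in realizations S P r a w -> j \in S -> G (x j) (h (x j)).
  by move=> xr jS; apply/hP/nb_le/(near _ _ xr jS); lia.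
rewrite -(card_in_imset (f := F)); last first.
  move=> x x' xr xr' /ffunP E; apply/ffunP=> j; have := E j; rewrite !ffunE.
  case: ifP => [jS hE|_]; last exact: finj.
  by apply: (isom_inj Gi (nearG x j xr jS)); rewrite hE; apply: nearG.
apply/subset_leq_card/subsetP=> _ /imsetP[x xr ->].
have := xr; rewrite inE => /andP[/agreeP xa /asboolP xw].
rewrite inE; apply/andP; split.
  apply/agreeP=> i iP; have iS := subsetP PS i iP; rewrite ffunE iS.
  by have := nearG x i xr iS; rewrite xa // => /(isom_fun Gi)/(_ (isom_base Gi iP)).
have GF j : j \in S -> G (x j) (F x j) by move=> jS; rewrite ffunE jS; apply: nearG.
apply/asboolP; apply: teq_trans xw; apply: teq_sym; split.
  by apply: isom_restrict Gi _ (fun j => near x j xr) GF; lia.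
move=> i j iS jS; split.
  exact: isom_link Gi mR (near x i xr iS) (near x j xr jS) (GF i iS) (GF j jS).
have nearF k : k \in S -> nb P (#|S :\: P| * (2 * r + 1)) b (F x k).
  by move=> kS; apply: isom_nb Gi _ (near x k xr kS) (GF k kS); lia.
exact: isom_link (isom_sym Gi) mR (nearF i iS) (nearF j jS) (GF i iS) (GF j jS).
Qed.

Lemma card_chained A B C (K : finType) (S P : {set K}) R r
    (a : K -> A) (b : K -> B) (w : K -> C) (f : A -> B) :
  bijective f -> iso P R a b -> P \subset S -> #|S :\: P| * (2 * r + 1) + r + 1 <= R ->
  chained S P r w -> #|realizations S P r a w| = #|realizations S P r b w|.
Proof.
move=> [g fK gK] ab PS mR ch; apply/eqP; rewrite eqn_leq.
rewrite (card_chained_le (can_inj fK) ab PS mR ch).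
by rewrite (card_chained_le (can_inj gK) (iso_sym ab) PS mR ch).
Qed.

(* If [S] splits into parts unlinked in [w], realizations of the type of [w] are
   the pairs of realizations of its two parts, minus the pairs that happen to be
   linked; the types of the latter have more links, whence the inner induction. *)
Lemma card_realizations A B (K : finType) R r (f : A -> B) :
  bijective f ->
  (forall c, iso (predT : {pred unit}) R (fun=> c) (fun=> f c)) ->
  forall (S P : {set K}) (a : K -> A) (b : K -> B),
  iso P R a b -> P \subset S -> #|S :\: P| * (2 * r + 1) + r + 1 <= R ->
  forall C (w : K -> C), #|realizations S P r a w| = #|realizations S P r b w|.
Proof.
move=> fbij fR S; have [n] := ubnP #|S|; elim: n S => // n IHn S Sn P a b ab PS mR C w.
pose links (C' : structure s) (w' : K -> C') :=
  [set p : K * K | [&& p.1 \in S, p.2 \in S & `[< link r (w' p.1) (w' p.2) >]]].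
have [m] := ubnP (#|{: K * K}| - #|links C w|); elim: m C w => // m IHm C w lm.
(* [P'] is the set that chains start from: [P], or a single index if [P] is empty and [S] is not. In
   the latter case the value [c] of that entry is summed over and matched with [f c]. Non-emptiness
   of [P'] later makes both parts of a splitting proper. *)
have [P' [PP' P'S P'0 base]] : exists P' : {set K}, [/\ P \subset P', P' \subset S,
    (P' = set0 -> S = set0) & chained S P' r w ->
      #|realizations S P r a w| = #|realizations S P r b w|].
  case: (set_0Vmem P) => [P0|[i iP]]; last first.
    exists P; split=> //; first by move=> P0; rewrite P0 inE in iP.
    exact: card_chained fbij ab PS mR.
  case: (set_0Vmem S) => [S0|[i iS]].
    by exists P; split=> //; exact: card_chained fbij ab PS mR.
  exists [set i]; split; rewrite ?P0 ?sub0set ?sub1set //.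
    by move/setP/(_ i); rewrite !inE eqxx.
  move=> ch.
  have part (D : structure s) (d : K -> D) : #|realizations S set0 r d w| =
      \sum_(c : D) #|realizations S [set i] r (fun=> c) w|.
    rewrite -sum1_card (partition_big (fun x : {ffun K -> D} => x i) predT) //=.
    apply: eq_bigr => c _; rewrite sum1dep_card; apply: eq_card => x; rewrite !inE.
    rewrite (_ : agree set0 d x); last by apply/agreeP=> j; rewrite inE.
    rewrite andbC; congr (_ && _); apply/eqP/agreeP => [xi j|]; first by rewrite inE => /eqP->.
    by apply; rewrite inE.
  rewrite !part [RHS](reindex f); last exact: onW_bij.
  apply: eq_bigr => c _; apply: (card_chained fbij _ _ _ ch); first last.
  - apply: leq_trans mR; rewrite P0 setD0 !leq_add2r leq_mul2r.
    by rewrite subset_leq_card ?subsetDl ?orbT.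
  - by rewrite sub1set.
  - by apply: iso_sub (fR c) _ _ => // j _; exists tt.
case: (EM (chained S P' r w)) => [/base //|].
move=> /existsNP[S0 /not_implyP[PS0 /not_implyP[S0S /not_implyP[neS nl]]]].
set S1 := S :\: S0 in nl.
pose linked (C' : structure s) (w' : K -> C') := exists i j, [/\ i \in S0, j \in S1 & link r (w' i) (w' j)].
have S1S : S1 \subset S by apply: subsetDl.
have SE : S =i [predU S0 & S1].
  move=> i; rewrite !inE; case: (boolP (i \in S0)) => //= iS0.
  exact: (subsetP S0S).
have PS0' : P \subset S0 by apply: subset_trans PS0.
have S0n : #|S0| < n.
  by rewrite -ltnS; apply: leq_trans Sn; rewrite ltnS; apply: proper_card; rewrite properEneq neS.
have S1n : #|S1| < n.
  rewrite -ltnS; apply: leq_trans Sn; rewrite ltnS; apply: proper_card.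
  rewrite properE S1S; apply: contra neS => SS1.
  have S00 : S0 = set0.
    apply/setP=> i; rewrite inE; apply/negP=> iS0.
    by have := subsetP SS1 i (subsetP S0S i iS0); rewrite inE iS0.
  by rewrite S00 P'0 //; apply/eqP; rewrite -subset0 -S00.
have ab0 : iso (set0 : {set K}) R a b.
  by apply: iso_sub ab _ _ => // j; rewrite inE.
(* All of [P] lies in [S0], so [S1] is counted over the empty base; it fits the same radius because
   it is contained in [S :\: P]. *)
have E0 := IHn S0 S0n P a b ab PS0' _ C w.
have E1 := IHn S1 S1n set0 a b ab0 (sub0set _) _ C w.
have {}E0 : #|realizations S0 P r a w| = #|realizations S0 P r b w|.
  apply: E0; apply: leq_trans mR; rewrite !leq_add2r leq_mul2r.
  by rewrite subset_leq_card ?setSD ?orbT.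
have {}E1 : #|realizations S1 set0 r a w| = #|realizations S1 set0 r b w|.
  apply: E1; apply: leq_trans mR; rewrite !leq_add2r leq_mul2r.
  by rewrite subset_leq_card ?orbT // setD0 /S1 setDS.
pose pairs (D : structure s) (d : K -> D) := [set x : {ffun K -> D} |
  agree P d x && (`[< teq S0 r x w >] && `[< teq S1 r x w >])].
have pairsE (D : structure s) (d : K -> D) : #|realizations S0 P r d w| * #|realizations S1 set0 r d w| =
    #|pairs D d| * #|{: {ffun K -> D}}|.
  have agree0 x : agree set0 d x by apply/agreeP=> i; rewrite inE.
  rewrite (card_indep (S0 := S0) (S1 := S1)); first last.
  - by move=> x y xy; rewrite !agree0; apply/asboolP/asboolP; apply: eq_teq => // i iS; rewrite xy.
  - move=> x y xy; congr (_ && _).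
      by apply/agreeP/agreeP => h i iP; rewrite -h // xy // (subsetP PS0').
    by apply/asboolP/asboolP; apply: eq_teq => // i iS; rewrite xy.
  - by rewrite disjoints_subset; apply/subsetP=> i iS0; rewrite !inE iS0.
  by congr (_ * _); apply: eq_card => x; rewrite !inE agree0 /= andbA.
have Epairs : #|pairs A a| = #|pairs B b|.
  have A0 : 0 < #|{: {ffun K -> A}}| by apply/card_gt0P; exists [ffun=> elt0 A].
  apply/eqP; rewrite -(eqn_pmul2r A0) -pairsE E0 E1 pairsE.
  by rewrite !card_ffun (bij_eq_card fbij).
pose bad (D : structure s) (d : K -> D) := [set x : {ffun K -> D} | agree P d x &&
  `[< [/\ teq S0 r x w, teq S1 r x w & linked D x] >]].
have S0in i : i \in S0 -> i \in S by move/(subsetP S0S).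
have S1in i : i \in S1 -> i \in S by move/(subsetP S1S).
(* Bad families are sorted by their full type on [S], represented by a family in an arbitrary
   structure. *)
have Ebad : #|bad A a| = #|bad B b|.
  apply: (@card_classes _ _ {D : structure s & K -> D}
    (fun p q => teq S r (projT2 p) (projT2 q))
    (fun x : {ffun K -> A} => existT _ A (x : K -> A))
    (fun x : {ffun K -> B} => existT _ B (x : K -> B)) (agree P a) (agree P b)
    (fun p => [/\ teq S0 r (projT2 p) w, teq S1 r (projT2 p) w & linked _ (projT2 p)])).
  - by move=> p; apply: teq_refl.
  - by move=> p q; apply: teq_sym.
  - by move=> p q o; apply: teq_trans.
  - move=> [D p] [D' q] /= pq [p0 p1 [i [j [iS jS pij]]]]; have qp := teq_sym pq.
    split; [exact: teq_trans (teq_sub S0in qp) p0 | exact: teq_trans (teq_sub S1in qp) p1|].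
    by exists i, j; split=> //; apply/qp.2; auto.
  (* A bad type keeps the links of [w] inside each part; [w] has none across and [p] has one, so the
     inner induction applies to [p]. *)
  - move=> [D p] /= [p0 p1 [i [j [iS jS pij]]]]; apply: IHm.
    suff : #|links C w| < #|links D p|.
      move=> lt; rewrite -ltnS; apply: leq_trans lm; rewrite ltnS.
      by apply: ltn_sub2l (lt); apply: leq_trans lt (max_card _).
    apply: proper_card; apply/properP; split.
      apply/subsetP=> -[k k']; rewrite !inE /= => /and3P[kS k'S /asboolP wk].
      rewrite kS k'S; apply/asboolP; move: kS k'S; rewrite !SE => /orP[] kS /orP[] k'S.
      - exact/p0.2.
      - by case: nl; exists k, k'.
      - by case: nl; exists k', k; split=> //; apply: ball_sym.
      - exact/p1.2.
    exists (i, j); first by rewrite inE /= S0in ?S1in //; apply/asboolP.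
    by rewrite inE /= S0in ?S1in //; apply/asboolP => wij; apply: nl; exists i, j.
have realE (D : structure s) (d : K -> D) : #|realizations S P r d w| = #|pairs D d| - #|bad D d|.
  have /setIidPr <- : bad D d \subset pairs D d.
    apply/subsetP=> x; rewrite !inE => /andP[-> /asboolP[x0 x1 _]] /=.
    by apply/andP; split; apply/asboolP.
  rewrite -cardsD; apply: eq_card => x; rewrite !inE; case: (agree P d x) => //=.
  apply/asboolP/andP => [xw|[nb /andP[/asboolP x0 /asboolP x1]]].
    split; last by apply/andP; split; apply/asboolP; apply: teq_sub xw.
    apply/negP=> /asboolP[_ _ [i [j [iS jS xij]]]]; apply: nl; exists i, j; split=> //.
    by apply/xw.2; auto.
  apply: (teq_glue SE x0 x1) => i j iS jS ij; last by apply: nl; exists i, j.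
  by case/negP: nb; apply/asboolP; split=> //; exists i, j.
by rewrite !realE Epairs Ebad.
Qed.

End Types.

(** * Satisfaction and quantifier blocks *)

Section Formulas.
Variable s : signature.
Implicit Types A B C : structure s.

Definition same_balls R A B : Prop :=
  exists2 f : A -> B, bijective f &
    forall c, iso (predT : {pred unit}) R (fun=> c) (fun=> f c).

Lemma same_balls_sym R A B : same_balls R A B -> same_balls R B A.
Proof.
case=> f [g fK gK] fR; exists g; first by exists f.
by move=> c; apply: iso_sym; rewrite -{2}(gK c).
Qed.

Lemma same_balls_le R R' A B : R' <= R -> same_balls R A B -> same_balls R' A B.
Proof.
move=> RR' [f fbij fR]; exists f => // c.
by apply: iso_sub (fR c) _ _ => // j _; exists j.
Qed.

Lemma eq_sat A (nu nu' : nat -> A) (phi : formula s) :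
  nu =1 nu' -> sat nu phi <-> sat nu' phi.
Proof.
have eq_upd (mu mu' : nat -> A) x a : mu =1 mu' -> upd mu x a =1 upd mu' x a.
  by move=> h v; rewrite /upd h.
elim: phi nu nu' => [x y|R xs|g IH|g IHg h IHh|g IHg h IHh|x g IH|x g IH] nu nu' E /=.
- by rewrite !E.
- suff -> : map_tuple nu xs = map_tuple nu' xs by [].
  by apply: eq_from_tnth => i; rewrite !tnth_map E.
- by rewrite (IH _ _ E).
- by rewrite (IHg _ _ E) (IHh _ _ E).
- by rewrite (IHg _ _ E) (IHh _ _ E).
- by split=> -[a] h; exists a; apply/(IH _ _ (eq_upd _ _ x a E)).
- by split=> h a; apply/(IH _ _ (eq_upd _ _ x a E)).
Qed.

(** Nested updates collapse into one change of assignment, which allows a block to be answered in a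
    single move. *)
Lemma sat_exs A (nu : nat -> A) xs (psi : formula s) :
  sat nu (exs xs psi) <-> exists2 nu' : nat -> A, {in [predC xs], nu' =1 nu} & sat nu' psi.
Proof.
elim: xs nu => [|x xs IH] nu /=.
  by split=> [h|[nu' E h]]; [exists nu | apply/(eq_sat (nu' := nu')) => // v; rewrite E].
split=> [[a /IH[nu' E h]]|[nu' E h]].
  exists nu' => // v; rewrite !inE negb_or => /andP[vx vxs].
  by rewrite E // /upd (negPf vx).
exists (nu' x); apply/IH; exists nu' => // v vxs; rewrite /upd; case: eqP => [->//|/eqP vx].
by apply: E; rewrite !inE negb_or vx.
Qed.

Lemma mem_fv_exs xs (psi : formula s) v :
  (v \in fv (exs xs psi)) = (v \in fv psi) && (v \notin xs).
Proof.
elim: xs => [|x xs IH] /=; first by rewrite andbT.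
by rewrite mem_filter IH /= inE negb_or andbCA.
Qed.

(** The variables in [F] serve as indices, those outside [xs] as the base. The type of [nu'] is
    realized over [nu] by [nu'] itself, so by equality of counts it is realized over [mu]. *)
Lemma extend_block A B R r (F xs : seq nat) (nu nu' : nat -> A) (mu : nat -> B) :
  same_balls R A B -> iso [pred v in F | v \notin xs] R nu mu ->
  size xs * (2 * r + 1) + r + 1 <= R -> {in [predC xs], nu' =1 nu} ->
  exists2 mu' : nat -> B, {in [predC xs], mu' =1 mu} & iso (mem F) r nu' mu'.
Proof.
move=> [f fbij fR] nm xsR E.
pose K := {: seq_sub F}; pose P := [set k : K | ssval k \notin xs].
pose w (k : K) := nu' (ssval k).
have PR : #|[set: K] :\: P| * (2 * r + 1) + r + 1 <= R.
  apply: leq_trans xsR; rewrite !leq_add2r leq_mul2r; apply/orP; right.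
  rewrite cardE -(size_map val); apply: uniq_leq_size.
    by rewrite map_inj_uniq ?enum_uniq //; apply: val_inj.
  by move=> _ /mapP[k kP ->]; move: kP; rewrite mem_enum !inE negbK andbT.
have ab : iso P R (fun k : K => nu (ssval k)) (fun k : K => mu (ssval k)).
  apply: iso_sub nm _ _ => // k; rewrite inE => kxs; exists (ssval k).
  by split=> //; rewrite inE kxs (ssvalP k).
have /card_gt0P[y] : 0 < #|realizations [set: K] P r (fun k : K => mu (ssval k)) w|.
  rewrite -(card_realizations fbij fR ab (subsetT P) PR w); apply/card_gt0P.
  exists [ffun k => w k]; rewrite inE; apply/andP; split.
    by apply/agreeP=> k; rewrite inE ffunE => /E.
  by apply/asboolP; apply: eq_teq (teq_refl _ _ _) => k _; rewrite ffunE.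
rewrite inE => /andP[/agreeP yb /asboolP[[G Gi] _]].
(* Variables of [xs] that are not in [F] carry no constraint and keep their value. *)
pose mu' v := if v \in xs then (if insub v is Some k then y k else mu v) else mu v.
have mu'E k : mu' (ssval k) = y k.
  rewrite /mu'; case: ifP => kxs; last by rewrite yb // inE kxs.
  by rewrite (valK k).
exists mu' => [v|]; first by rewrite inE /mu' => /negPf->.
apply: (iso_sub (iso_sym (ex_intro _ G Gi))) => // v vF.
by exists (SeqSub vF); split; rewrite -?mu'E ?in_setT.
Qed.

Lemma sat_qfree A B r (nu : nat -> A) (mu : nat -> B) (phi : formula s) :
  qfree phi -> iso (mem (fv phi)) r nu mu -> sat nu phi <-> sat mu phi.
Proof.
move=> qf [G Gi]; have GS v : v \in fv phi -> G (nu v) (mu v) by apply: (isom_base Gi).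
(* The domain of [G] is generalized so that one isomorphism serves all subformulas. *)
move: (mem _) Gi => S Gi; elim: phi qf GS => [x y|R xs|g IH|g IHg h IHh|g IHg h IHh|//|//] /= qf GS.
- have Gx : G (nu x) (mu x) by apply: GS; rewrite inE eqxx.
  have Gy : G (nu y) (mu y) by apply: GS; rewrite !inE eqxx orbT.
  split=> E; first by rewrite E in Gx; apply: (isom_fun Gi Gx Gy).
  by rewrite E in Gx; apply: (isom_inj Gi Gx Gy).
- rewrite (isom_rel Gi (t' := map_tuple mu xs)) // => i; rewrite !tnth_map.
  by apply: GS; apply: mem_tnth.
- by rewrite IH.
- case/andP: qf => qg qh; rewrite IHg ?IHh // => v vf; apply: GS;
    by rewrite mem_cat vf ?orbT.
- case/andP: qf => qg qh; rewrite IHg ?IHh // => v vf; apply: GS;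
    by rewrite mem_cat vf ?orbT.
Qed.

Lemma iso_cat A B r (F F' : seq nat) (nu : nat -> A) (mu : nat -> B) :
  iso (mem (F ++ F')) r nu mu -> iso (mem F) r nu mu /\ iso (mem F') r nu mu.
Proof.
by move=> nm; split; apply: iso_sub nm _ _ => // v vF; exists v; split=> //;
  rewrite mem_cat; apply/orP; [left | right].
Qed.

Lemma sat_BSigma l n (phi : formula s) : BSigma n l phi ->
  forall A B (nu : nat -> A) (mu : nat -> B), same_balls ((2 * l + 1) ^ n - 1) A B ->
  iso (mem (fv phi)) ((2 * l + 1) ^ n - 1) nu mu -> sat nu phi <-> sat mu phi.
Proof.
elim: n phi => [|n IHn] phi; first by move=> qf A B nu mu _; apply: sat_qfree.
have pos : 0 < (2 * l + 1) ^ n by rewrite expn_gt0 addn1.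
set q := (2 * l + 1) ^ n in IHn pos.
have rle : q - 1 <= (2 * l + 1) ^ n.+1 - 1 by rewrite expnS -/q; nia.
elim=> {phi} [phi [xs [psi [sxs [Bpsi ->]]]]|g _ IH|g h _ IHg _ IHh|g h _ IHg _ IHh].
- have dir A B (nu : nat -> A) (mu : nat -> B) :
      same_balls ((2 * l + 1) ^ n.+1 - 1) A B ->
      iso (mem (fv (exs xs psi))) ((2 * l + 1) ^ n.+1 - 1) nu mu ->
      sat nu (exs xs psi) -> sat mu (exs xs psi).
    move=> AB nm /sat_exs[nu' E nu'psi]; apply/sat_exs.
    (* The empty block is treated apart: for [l = 0] the available radius is [0], which leaves no
       room for the margin [r + 1]. *)
    have [xs0|xs0] := posnP (size xs).
      move/size0nil: xs0 nm E => -> nm E; exists mu => //.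
      have nm' : iso (mem (fv psi)) (q - 1) nu' mu.
        by apply: iso_sub nm rle _ => v vpsi; exists v; rewrite E.
      exact/(IHn _ Bpsi _ _ _ _ (same_balls_le rle AB) nm').
    have nm' : iso [pred v in fv psi | v \notin xs] ((2 * l + 1) ^ n.+1 - 1) nu mu.
      by apply: iso_sub nm _ _ => // v vpsi; exists v; split=> //; rewrite mem_fv_exs.
    (* The left side is at most [l (2 q - 1) + q = (2 l + 1) q - l], and [l] is positive since the
       block is not empty. *)
    have xsR : size xs * (2 * (q - 1) + 1) + (q - 1) + 1 <= (2 * l + 1) ^ n.+1 - 1.
      apply: (@leq_trans (l * (2 * (q - 1) + 1) + (q - 1) + 1)).
        by rewrite !leq_add2r leq_mul2r sxs orbT.
      by rewrite expnS -/q; nia.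
    have [mu' E' nm''] := extend_block AB nm' xsR E.
    by exists mu' => //; apply/(IHn _ Bpsi _ _ _ _ (same_balls_le rle AB) nm'').
  by move=> A B nu mu AB nm; split; apply: dir => //; [apply: same_balls_sym | apply: iso_sym].
- by move=> A B nu mu AB nm /=; rewrite (IH _ _ _ _ AB nm).
- move=> A B nu mu AB nm /=; have [] := iso_cat nm => ng nh.
  by rewrite (IHg _ _ _ _ AB ng) (IHh _ _ _ _ AB nh).
- move=> A B nu mu AB nm /=; have [] := iso_cat nm => ng nh.
  by rewrite (IHg _ _ _ _ AB ng) (IHh _ _ _ _ AB nh).
Qed.

(** In the sphere of [rcons a c], position [k] alone gives the sphere of [c], and the positions
    below [k] give that of [a], for which any [c] will do. *)
Lemma r_equiv_iso A B r k (a : k.-tuple A) (b : k.-tuple B) :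
  r_equiv r a b -> same_balls r A B /\ iso [pred v | v < k] r (asg a) (asg b).
Proof.
case=> f [fbij fR]; have {}fR c := sphere_iso_iso (fR c).
split; last first.
  apply: iso_sub (fR (elt0 A)) _ _ => // v vk; exists v.
  rewrite inE in vk; rewrite inE size_rcons size_tuple leqW //.
  by split=> //; rewrite /asg nth_rcons size_tuple vk.
exists f => // c; apply: iso_sub (fR c) _ _ => // j _; exists k.
by rewrite inE size_rcons size_tuple /asg !nth_rcons !size_tuple ltnn eqxx.
Qed.

(** * Formula length and the size of quantifier blocks *)

Lemma flen_gt0 (phi : formula s) : 0 < flen phi.
Proof. by case: phi => //= *; rewrite addn3. Qed.

Lemma flen_exs xs (psi : formula s) : flen (exs xs psi) = 2 * size xs + flen psi.
Proof. by elim: xs => //= x xs ->; lia. Qed.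

(** Each quantifier takes two symbols and the matrix at least one, so a block in a formula of length
    at most [2 m + 2] has at most [m] quantifiers. *)
Lemma BSigma_flen n l m (phi : formula s) :
  BSigma n l phi -> flen phi <= 2 * m + 2 -> BSigma n m phi.
Proof.
elim: n phi => [//|n IHn] phi /=.
elim=> {phi} [phi [xs [psi [sxs [Bpsi ->]]]]|g _ IH|g h _ IHg _ IHh|g h _ IHg _ IHh] /= len.
- have := flen_gt0 psi; rewrite flen_exs in len => psi0.
  by apply: bc_base; exists xs, psi; split; [lia | split=> //; apply: IHn => //; lia].
- by apply/bc_not/IH; lia.
- by apply: bc_and; [apply: IHg | apply: IHh]; lia.
- by apply: bc_or; [apply: IHg | apply: IHh]; lia.
Qed.

End Formulas.

Theorem theorem5p6 (s : signature) (phi : formula s) (k n l : nat) :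
  0 < k ->
  all (fun v => v < k) (fv phi) ->
  BSigma n l phi ->
  (exists r, r < (2 * l + 1) ^ n /\ hanf_at k phi r) /\
  ((forall l', l' < l -> ~ BSigma n l' phi) -> (2 * l + 1) ^ n <= flen phi ^ n).
Proof.
move=> _ /allP fvk Bphi; split.
  have pos : 0 < (2 * l + 1) ^ n by rewrite expn_gt0 addn1.
  exists ((2 * l + 1) ^ n - 1); split; first by rewrite subn1 prednK.
  move=> A B a b /r_equiv_iso[AB ab]; apply: (sat_BSigma Bphi AB).
  by apply: iso_sub ab _ _ => // v /fvk vk; exists v.
move=> lmin; case: n Bphi lmin => [|n] Bphi lmin; first by rewrite !expn0.
rewrite leq_exp2r //; have := flen_gt0 phi => len0.
(* If the length were at most [2 l = 2 (l - 1) + 2], blocks of size [l - 1] would suffice, against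
   the minimality of [l]; here [l] is positive because the length is. *)
case: (leqP (2 * l + 1) (flen phi)) => // lt; exfalso.
have [l'] : exists l', l' < l /\ flen phi <= 2 * l' + 2 by exists l.-1; lia.
by case=> l'l len; apply: (lmin l' l'l); apply: BSigma_flen Bphi len.
Qed.
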